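(* Let $M$ be a regular spacelike surface in $E_1^3$ and let $\alpha$ be a unit speed isophote curve on $M$ with timelike axis, with timelike principal normal and curvature $\kappa\ne 0$; let $\tau$ be its torsion, $\{T,B,N\}$ its Darboux frame, and $\theta$ the constant hyperbolic angle between the surface normal $N$ and the axis. Then $\alpha$ is a geodesic on $M$ if and only if $\alpha$ is a slant helix with the timelike fixed vector $$d=\pm\frac{\tau}{\sqrt{\kappa^2+\tau^2}}\sinh\theta\,T\mp\frac{\kappa}{\sqrt{\kappa^2+\tau^2}}\sinh\theta\,B+\cosh\theta\,N .$$
   Context: $E_1^3$ is $\mathbb{R}^3$ with the inner product $\langle x,y\rangle=-x_1y_1+x_2y_2+x_3y_3$. A vector $x$ is timelike if $\langle x,x\rangle<0$. A surface is spacelike if its induced metric is positive definite; its unit normal $N$ is then timelike, $\langle N,N\rangle=-1$, and every regular curve on it is spacelike. The Lorentzian cross product is $x\times y=(x_2y_3-x_3y_2,\;x_1y_3-x_3y_1,\;x_2y_1-x_1y_2)$. For a unit speed spacelike curve with timelike principal normal the Frenet frame $\{t,n,b\}$ ($\langle t,t\rangle=\langle b,b\rangle=1$, $\langle n,n\rangle=-1$) satisfies $t'=\kappa n$, $n'=\kappa t+\tau b$, $b'=\tau n$, where $\kappa$ is the curvature and $\tau$ the torsion. For a unit speed curve $\alpha$ on the spacelike surface $M$, the Darboux frame is $\{T,\,B=N\times T,\,N\}$ with $T=\alpha'$ and $N$ the unit normal of $M$ along $\alpha$. The functions $k_g,k_n,\tau_g$ (geodesic curvature, normal curvature, geodesic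 torsion) are defined by $T'=k_gB+k_nN$, $B'=-k_gT+\tau_gN$, $N'=k_nT+\tau_gB$. The frames are related (with the paper's choice of orientations) by an angle function $\phi$ with $k_n=\kappa\cosh\phi$, $k_g=\kappa\sinh\phi$, $\tau_g=\tau+\phi'$, so $\kappa^2=k_n^2-k_g^2$. The curve $\alpha$ is a geodesic on $M$ if $k_g=0$ along $\alpha$. Isophote curve with timelike axis: there is a fixed unit timelike vector $d$ ($\langle d,d\rangle=-1$), the axis, in the same timecone as $N$, such that $\langle N,d\rangle=-\cosh\theta$ is constant along $\alpha$, with $\theta\ge0$ the hyperbolic angle between $N$ and $d$. A slant helix with fixed vector $d$ is a curve whose principal normal $n$ makes a constant angle with the fixed direction $d$, i.e. $d$ is a constant vector and $\langle n,d\rangle$ is constant along the curve. The signs $\pm,\mp$ in the formula are correlated. *)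

(* Defs.v *)
(* Vectors are triples ((x1, x2), x3), which
   Coquelicot equips with its product normed-module structure, so [is_derive],
   [plus], [scal], [open] apply to them directly. *)
From Stdlib Require Import Reals.
From Coquelicot Require Import Coquelicot.
Open Scope R_scope.

Definition E13 : Type := (R * R * R)%type.

Definition x1 (v : E13) : R := fst (fst v).
Definition x2 (v : E13) : R := snd (fst v).
Definition x3 (v : E13) : R := snd v.

Definition inner (v w : E13) : R := - (x1 v * x1 w) + x2 v * x2 w + x3 v * x3 w.

Definition cross (v w : E13) : E13 :=
  (x2 v * x3 w - x3 v * x2 w,
   x1 v * x3 w - x3 v * x1 w,
   x2 v * x1 w - x1 v * x2 w).

Definition timelike (v : E13) : Prop := inner v v < 0.

(* Meaningful for timelike vectors only. *)
Definition same_timecone (v w : E13) : Prop := inner v w < 0.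

Definition partial_u (X : R * R -> E13) (w : R * R) : E13 :=
  (Derive (fun z => x1 (X (z, snd w))) (fst w),
   Derive (fun z => x2 (X (z, snd w))) (fst w),
   Derive (fun z => x3 (X (z, snd w))) (fst w)).

Definition partial_v (X : R * R -> E13) (w : R * R) : E13 :=
  (Derive (fun z => x1 (X (fst w, z))) (snd w),
   Derive (fun z => x2 (X (fst w, z))) (snd w),
   Derive (fun z => x3 (X (fst w, z))) (snd w)).

Definition dmap (X : R * R -> E13) (w : R * R) (a b : R) : E13 :=
  plus (scal a (partial_u X w)) (scal b (partial_v X w)).

Definition smooth_map (U : R * R -> Prop) (X : R * R -> E13) : Prop :=
  forall w, U w -> forall k : nat,
    ex_diff_n (fun u v => x1 (X (u, v))) k (fst w) (snd w) /\
    ex_diff_n (fun u v => x2 (X (u, v))) k (fst w) (snd w) /\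
    ex_diff_n (fun u v => x3 (X (u, v))) k (fst w) (snd w).

(* X restricts to a smooth immersion and a homeomorphism from the open set U
   onto a relatively open subset of M; Y is the inverse homeomorphism. *)
Definition local_param (M : E13 -> Prop) (U : R * R -> Prop) (X : R * R -> E13) : Prop :=
  open U /\
  smooth_map U X /\
  (forall w, U w -> forall a b, dmap X w a b = zero -> a = 0 /\ b = 0) /\
  exists (V : E13 -> Prop) (Y : E13 -> R * R),
    open V /\
    (forall q, M q /\ V q <-> exists w, U w /\ X w = q) /\
    (forall w, U w -> Y (X w) = w) /\
    (forall q, M q -> V q ->
       filterlim Y (within (fun p => M p /\ V p) (locally q)) (locally (Y q))).

Definition regular_surface (M : E13 -> Prop) : Prop :=
  forall p, M p -> exists U X, local_param M U X /\ exists w, U w /\ X w = p.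

Definition tangent (M : E13 -> Prop) (p v : E13) : Prop :=
  exists U X w a b, local_param M U X /\ U w /\ X w = p /\ v = dmap X w a b.

Definition spacelike_surface (M : E13 -> Prop) : Prop :=
  regular_surface M /\
  forall p v, M p -> tangent M p v -> v <> zero -> 0 < inner v v.

Definition unit_normal_at (M : E13 -> Prop) (p N : E13) : Prop :=
  inner N N = -1 /\ forall v, tangent M p v -> inner N v = 0.

Definition interval (lo hi : Rbar) (s : R) : Prop := Rbar_lt lo s /\ Rbar_lt s hi.

Definition smooth_curve (I : R -> Prop) (alpha : R -> E13) : Prop :=
  forall s, I s -> forall k : nat,
    ex_derive_n (fun u => x1 (alpha u)) k s /\
    ex_derive_n (fun u => x2 (alpha u)) k s /\
    ex_derive_n (fun u => x3 (alpha u)) k s.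

Definition unit_speed_on (M : E13 -> Prop) (I : R -> Prop) (alpha T : R -> E13) : Prop :=
  smooth_curve I alpha /\
  forall s, I s ->
    M (alpha s) /\ is_derive alpha s (T s) /\ inner (T s) (T s) = 1.

(* Frenet apparatus of a unit speed spacelike curve with timelike principal
   normal.  The condition b = n x t fixes the sign of b, hence of tau, in the
   same way as B = N x T does for the Darboux frame. *)
Definition frenet (I : R -> Prop) (t n b : R -> E13) (kappa tau : R -> R) : Prop :=
  forall s, I s ->
    inner (t s) (t s) = 1 /\ inner (n s) (n s) = -1 /\ inner (b s) (b s) = 1 /\
    inner (t s) (n s) = 0 /\ inner (t s) (b s) = 0 /\ inner (n s) (b s) = 0 /\
    b s = cross (n s) (t s) /\
    is_derive t s (scal (kappa s) (n s)) /\
    is_derive n s (plus (scal (kappa s) (t s)) (scal (tau s) (b s))) /\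
    is_derive b s (scal (tau s) (n s)).

Definition darboux (M : E13 -> Prop) (I : R -> Prop) (alpha T B N : R -> E13)
    (kg kn taug : R -> R) : Prop :=
  forall s, I s ->
    unit_normal_at M (alpha s) (N s) /\
    B s = cross (N s) (T s) /\
    is_derive T s (plus (scal (kg s) (B s)) (scal (kn s) (N s))) /\
    is_derive B s (plus (scal (- kg s) (T s)) (scal (taug s) (N s))) /\
    is_derive N s (plus (scal (kn s) (T s)) (scal (taug s) (B s))).

(* Orientation of the Frenet frame relative to the Darboux frame: together with
   the two sets of frame equations this says that
     n = cosh phi N + sinh phi B   and   b = sinh phi N + cosh phi B,
   so n and N lie in the same timecone.  The relation between taug, tau and
   phi' follows from the frame equations and is not assumed; with this sign of
   phi it reads taug = tau - phi'. *)
Definition frames_angle (I : R -> Prop) (kappa kg kn phi : R -> R) : Prop :=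
  forall s, I s ->
    kn s = kappa s * cosh (phi s) /\ kg s = kappa s * sinh (phi s).

Definition geodesic (I : R -> Prop) (kg : R -> R) : Prop := forall s, I s -> kg s = 0.

Definition isophote_timelike (I : R -> Prop) (N : R -> E13) (theta : R) : Prop :=
  0 <= theta /\
  exists d : E13, inner d d = -1 /\
    forall s, I s -> same_timecone (N s) d /\ inner (N s) d = - cosh theta.

Definition slant_helix (I : R -> Prop) (n : R -> E13) (d : E13) : Prop :=
  exists c : R, forall s, I s -> inner (n s) d = c.

(* e = 1 and e = -1 give the two correlated choices of sign. *)
Definition slant_axis (e theta : R) (kappa tau : R -> R) (T B N : R -> E13) (s : R) : E13 :=
  plus
    (plus
      (scal (e * (tau s / sqrt (kappa s ^ 2 + tau s ^ 2)) * sinh theta) (T s))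
      (scal (- e * (kappa s / sqrt (kappa s ^ 2 + tau s ^ 2)) * sinh theta) (B s)))
    (scal (cosh theta) (N s)).

(* Main.v *)
(** Throughout, a = <T,d> and c = <B,d>.

    On a geodesic the two frames coincide, so differentiating the constant
    <n,d> gives kappa a + tau c = 0, while <d,d> = -1 gives
    a^2 + c^2 = sinh^2 theta.  Hence (a,c) is sinh theta times
    +-(tau,-kappa)/sqrt(kappa^2 + tau^2), and the sign cannot change because
    kappa c is continuous and, unless theta = 0, nowhere zero.

    Conversely, the formula for d gives kappa a + tau c = 0; subtracting this
    from the derivative of <n,d> leaves
    tau (c (cosh phi - 1) - sinh phi cosh theta) = 0.  As |c| < cosh theta, this
    forces tau = 0 or sinh phi = 0, so a sinh phi vanishes identically.  Where
    a = 0, differentiating this product and using a' <> 0 gives sinh phi = 0. *)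
Require Import Defs.
From Stdlib Require Import Reals Ranalysis5 Lra.
From Coquelicot Require Import Coquelicot.
Open Scope R_scope.

(** * Hyperbolic functions, and real functions on an interval *)

Lemma cosh_sqr (x : R) : cosh x ^ 2 = 1 + sinh x ^ 2.
Proof.
  unfold cosh, sinh.
  assert (H : exp x * exp (- x) = 1).
  { rewrite <- exp_plus, Rplus_opp_r; apply exp_0. }
  nra.
Qed.

Lemma cosh_pos (x : R) : 0 < cosh x.
Proof. unfold cosh. generalize (exp_pos x) (exp_pos (- x)). lra. Qed.

Lemma sinh_nonneg (x : R) : 0 <= x -> 0 <= sinh x.
Proof.
  intros [H | <-]; [| rewrite sinh_0; lra].
  unfold sinh. generalize (exp_increasing (- x) x ltac:(lra)). lra.
Qed.

Lemma locally_interval (lo hi : Rbar) (s : R) :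
  interval lo hi s -> locally s (interval lo hi).
Proof.
  apply (open_and (fun u : R => Rbar_lt lo u) (fun u : R => Rbar_lt u hi)).
  - apply open_Rbar_gt.
  - apply open_Rbar_lt.
Qed.

Lemma interval_inhabited (lo hi : Rbar) :
  Rbar_lt lo hi -> exists s, interval lo hi s.
Proof.
  unfold interval; destruct lo as [a | |], hi as [b | |]; simpl; try tauto; intros H.
  - exists ((a + b) / 2); lra.
  - exists (a + 1); lra.
  - exists (b - 1); lra.
  - exists 0; tauto.
Qed.

Lemma interval_between (lo hi : Rbar) (s t u : R) :
  interval lo hi s -> interval lo hi t -> s <= u <= t -> interval lo hi u.
Proof.
  unfold interval; destruct lo as [a | |], hi as [b | |]; simpl; intuition lra.
Qed.

(** By the intermediate value theorem, opposite signs would force a zero in between. This makes one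
    choice of [e] valid along the whole curve. *)
Lemma interval_constant_sign (lo hi : Rbar) (f : R -> R) :
  (forall s, interval lo hi s -> continuity_pt f s) ->
  (forall s, interval lo hi s -> f s <> 0) ->
  forall s t, interval lo hi s -> interval lo hi t -> 0 < f s * f t.
Proof.
  intros Hc Hn.
  assert (W : forall s t, interval lo hi s -> interval lo hi t -> s < t -> 0 < f s * f t).
  { intros s t Hs Ht Hst.
    assert (Hb := fun u => interval_between lo hi s t u Hs Ht).
    destruct (Rdichotomy _ _ (Hn s Hs)) as [Fs | Fs],
      (Rdichotomy _ _ (Hn t Ht)) as [Ft | Ft]; try nra.
    - destruct (IVT_interv f s t) as [z [Hz Ez]]; auto.
      destruct (Hn z (Hb z Hz) Ez).
    (* [IVT_interv] expects a negative value on the left, and here [f s] is positive. *)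
    - destruct (IVT_interv (fun u => - f u) s t) as [z [Hz Ez]]; try lra.
      + intros u Hu. apply continuity_pt_opp. auto.
      + destruct (Hn z (Hb z Hz)). lra. }
  intros s t Hs Ht.
  destruct (Rtotal_order s t) as [H | [<- | H]].
  - auto.
  - generalize (Hn s Hs). nra.
  - rewrite Rmult_comm. auto.
Qed.

(** Serves to differentiate identities known only on the interval: it is open, so [f] is constant
    near [s]. *)
Lemma is_derive_interval_constant (lo hi : Rbar) (f : R -> R) (k s l : R) :
  (forall u, interval lo hi u -> f u = k) ->
  interval lo hi s -> is_derive f s l -> l = 0.
Proof.
  intros Hf Hs Hl.
  rewrite <- (is_derive_unique _ _ _ Hl).
  rewrite (Derive_ext_loc f (fun _ => k)).
  - apply Derive_const.
  - apply (filter_imp (interval lo hi)); auto using locally_interval.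
Qed.

(** * Algebra of the Lorentzian inner and cross products *)

Lemma inner_sym (u v : E13) : inner u v = inner v u.
Proof. unfold inner. ring. Qed.

Lemma inner_plus_l (u v w : E13) : inner (plus u v) w = inner u w + inner v w.
Proof. unfold inner, x1, x2, x3, plus; simpl; unfold plus; simpl. ring. Qed.

Lemma inner_scal_l (k : R) (v w : E13) : inner (scal k v) w = k * inner v w.
Proof.
  unfold inner, x1, x2, x3, scal; simpl; unfold scal; simpl; unfold mult; simpl. ring.
Qed.

Lemma inner_plus_r (u v w : E13) : inner w (plus u v) = inner w u + inner w v.
Proof. now rewrite inner_sym, inner_plus_l, !(inner_sym w). Qed.

Lemma inner_scal_r (k : R) (v w : E13) : inner w (scal k v) = k * inner w v.
Proof. now rewrite inner_sym, inner_scal_l, (inner_sym w). Qed.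

Lemma inner_zero_r (v : E13) : inner v zero = 0.
Proof. unfold inner, x1, x2, x3, zero; simpl; unfold zero; simpl. ring. Qed.

Lemma E13_ext (v w : E13) : x1 v = x1 w -> x2 v = x2 w -> x3 v = x3 w -> v = w.
Proof. destruct v as [[]], w as [[]]; unfold x1, x2, x3; simpl; congruence. Qed.

Lemma inner_cross_l (v w : E13) : inner (cross v w) v = 0.
Proof. unfold inner, cross, x1, x2, x3; simpl. ring. Qed.

Lemma inner_cross_r (v w : E13) : inner (cross v w) w = 0.
Proof. unfold inner, cross, x1, x2, x3; simpl. ring. Qed.

(** Lagrange's identity, with the sign opposite to the Euclidean one. It makes N x T a unit
    spacelike vector. *)
Lemma inner_cross_cross (v w : E13) :
  inner (cross v w) (cross v w) = inner v w ^ 2 - inner v v * inner w w.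
Proof. unfold inner, cross, x1, x2, x3; simpl. ring. Qed.

(** In an orthonormal frame the coordinates are inner products; the one along [N] changes sign
    because <N,N> = -1. *)
Lemma frame_expansion (N T d : E13) :
  inner T T = 1 -> inner N N = -1 -> inner N T = 0 ->
  d = plus (plus (scal (inner T d) T) (scal (inner (cross N T) d) (cross N T)))
        (scal (- inner N d) N).
Proof.
  intros HT HN HNT.
  (* The component of d along N x T, before the frame is normalised. *)
  assert (G : scal (inner (cross N T) d) (cross N T) =
    plus (scal (inner N T ^ 2 - inner N N * inner T T) d)
      (plus (scal (inner N N * inner T d - inner N T * inner N d) T)
            (scal (inner T T * inner N d - inner N T * inner T d) N))).
  { apply E13_ext; unfold inner, cross, x1, x2, x3, plus, scal; simpl;
      unfold plus, scal; simpl; unfold mult; simpl; ring. }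
  rewrite G, HT, HN, HNT.
  apply E13_ext; unfold x1, x2, x3, plus, scal; simpl;
      unfold plus, scal; simpl; unfold mult; simpl; ring.
Qed.

(** * Derivatives of curves in Minkowski space *)

Lemma is_derive_linear {U V : NormedModule R_AbsRing} (l : U -> V) (f : R -> U) (s : R) (v : U) :
  is_linear l -> is_derive f s v -> is_derive (fun u => l (f u)) s (l v).
Proof.
  intros Hl Hf. unfold is_derive.
  apply (filterdiff_ext_lin _ (fun y : R => l (scal y v))).
  - apply (filterdiff_comp' f l s (fun y : R => scal y v) l Hf).
    now apply filterdiff_linear.
  - intros y. exact (linear_scal l Hl y v).
Qed.

Lemma is_derive_coords (f : R -> E13) (s : R) (v : E13) :
  is_derive f s v ->
  is_derive (fun u => x1 (f u)) s (x1 v) /\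
  is_derive (fun u => x2 (f u)) s (x2 v) /\
  is_derive (fun u => x3 (f u)) s (x3 v).
Proof.
  intros Hf.
  assert (H := is_derive_linear (fun p : R * R * R => fst p) f s v is_linear_fst Hf).
  split; [| split].
  - exact (is_derive_linear (fun p : R * R => fst p) _ s _ is_linear_fst H).
  - exact (is_derive_linear (fun p : R * R => snd p) _ s _ is_linear_snd H).
  - exact (is_derive_linear (fun p : R * R * R => snd p) f s v is_linear_snd Hf).
Qed.

Lemma is_derive_inner (f g : R -> E13) (s : R) (v w : E13) :
  is_derive f s v -> is_derive g s w ->
  is_derive (fun u => inner (f u) (g u)) s (inner v (g s) + inner (f s) w).
Proof.
  intros Hf Hg.
  destruct (is_derive_coords _ _ _ Hf) as (F1 & F2 & F3).
  destruct (is_derive_coords _ _ _ Hg) as (G1 & G2 & G3).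
  assert (P : forall p q : R -> R, forall dp dq, is_derive p s dp -> is_derive q s dq ->
    is_derive (fun u => p u * q u) s (dp * q s + p s * dq)).
  { intros p q dp dq Hp Hq. apply (is_derive_mult p q s dp dq Hp Hq Rmult_comm). }
  replace (inner v (g s) + inner (f s) w) with
    (- (x1 v * x1 (g s) + x1 (f s) * x1 w) + (x2 v * x2 (g s) + x2 (f s) * x2 w)
      + (x3 v * x3 (g s) + x3 (f s) * x3 w)) by (unfold inner; ring).
  unfold inner.
  apply (is_derive_plus (fun u => - (x1 (f u) * x1 (g u)) + x2 (f u) * x2 (g u))
           (fun u => x3 (f u) * x3 (g u))); [| now apply P].
  apply (is_derive_plus (fun u => - (x1 (f u) * x1 (g u))) (fun u => x2 (f u) * x2 (g u)));
    [| now apply P].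
  apply (is_derive_opp (fun u => x1 (f u) * x1 (g u))). now apply P.
Qed.

Lemma is_derive_inner_const (f : R -> E13) (s : R) (v d : E13) :
  is_derive f s v -> is_derive (fun u => inner (f u) d) s (inner v d).
Proof.
  intros Hf.
  replace (inner v d) with (inner v d + inner (f s) zero) by (rewrite inner_zero_r; ring).
  apply (is_derive_inner f (fun _ => d)); [exact Hf |].
  exact (is_derive_const (K := R_AbsRing) (V := prod_NormedModule R_AbsRing
    (prod_NormedModule R_AbsRing R_NormedModule R_NormedModule) R_NormedModule) d s).
Qed.

Lemma is_derive_continuity_pt (f : R -> R) (s l : R) : is_derive f s l -> continuity_pt f s.
Proof.
  intros Hf. apply continuity_pt_filterlim.
  apply (ex_derive_continuous f). now exists l.
Qed.

(** * Continuity of the curvature *)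

Lemma second_derivative_continuous (lo hi : Rbar) (f g h : R -> R) :
  (forall s, interval lo hi s -> ex_derive_n f 3 s) ->
  (forall s, interval lo hi s -> is_derive f s (g s)) ->
  (forall s, interval lo hi s -> is_derive g s (h s)) ->
  forall s, interval lo hi s -> continuity_pt h s.
Proof.
  intros Hf Hg Hh s Hs.
  assert (E : forall u, interval lo hi u -> Derive_n f 2 u = h u).
  { intros u Hu. simpl. rewrite (Derive_ext_loc _ g).
    - now apply is_derive_unique, Hh.
    - apply (filter_imp (interval lo hi)); [| now apply locally_interval].
      intros v Hv. now apply is_derive_unique, Hg. }
  apply continuity_pt_ext_loc with (Derive_n f 2).
  - apply (filter_imp (interval lo hi)); auto using locally_interval.
  (* Differentiability of order three says that the second derivative is itself differentiable,
     hence continuous. *)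
  - apply continuity_pt_filterlim, (ex_derive_continuous (Derive_n f 2)).
    exact (Hf s Hs).
Qed.

(** Since <n,n> = -1, kappa = -<T',n>. Here T' is the second derivative of the smooth curve, and [n]
    is continuous because the Frenet equations differentiate it. *)
Lemma curvature_continuous (M : E13 -> Prop) (lo hi : Rbar)
    (alpha T n b : R -> E13) (kappa tau : R -> R) :
  unit_speed_on M (interval lo hi) alpha T ->
  frenet (interval lo hi) T n b kappa tau ->
  forall s, interval lo hi s -> continuity_pt kappa s.
Proof.
  intros [Hsm Hu] Hfr s Hs.
  set (A := fun u => scal (kappa u) (n u) : E13).
  assert (HT : forall u, interval lo hi u -> is_derive T u (A u)).
  { intros u Hiu. apply (Hfr u Hiu). }
  assert (Ha : forall u, interval lo hi u -> is_derive alpha u (T u)).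
  { intros u Hiu. apply (Hu u Hiu). }
  assert (Hn : is_derive n s (plus (scal (kappa s) (T s)) (scal (tau s) (b s)))).
  { apply (Hfr s Hs). }
  destruct (is_derive_coords _ _ _ Hn) as (N1 & N2 & N3).
  apply is_derive_continuity_pt in N1, N2, N3.
  assert (A1 : continuity_pt (fun u => x1 (A u)) s).
  { apply (second_derivative_continuous lo hi (fun u => x1 (alpha u)) (fun u => x1 (T u)));
      auto; intros u Hiu; [apply (Hsm u Hiu) | |]; apply is_derive_coords; auto. }
  assert (A2 : continuity_pt (fun u => x2 (A u)) s).
  { apply (second_derivative_continuous lo hi (fun u => x2 (alpha u)) (fun u => x2 (T u)));
      auto; intros u Hiu; [apply (Hsm u Hiu) | |]; apply is_derive_coords; auto. }
  assert (A3 : continuity_pt (fun u => x3 (A u)) s).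
  { apply (second_derivative_continuous lo hi (fun u => x3 (alpha u)) (fun u => x3 (T u)));
      auto; intros u Hiu; [apply (Hsm u Hiu) | |]; apply is_derive_coords; auto. }
  apply continuity_pt_ext_loc with (fun u => - inner (A u) (n u)).
  - apply (filter_imp (interval lo hi)); [| now apply locally_interval].
    intros u Hiu. unfold A. rewrite inner_scal_l.
    destruct (Hfr u Hiu) as (_ & -> & _). ring.
  - unfold inner.
    apply (continuity_pt_opp (fun u => - (x1 (A u) * x1 (n u)) + x2 (A u) * x2 (n u)
             + x3 (A u) * x3 (n u))).
    apply (continuity_pt_plus (fun u => - (x1 (A u) * x1 (n u)) + x2 (A u) * x2 (n u))
             (fun u => x3 (A u) * x3 (n u))).
    + apply (continuity_pt_plus (fun u => - (x1 (A u) * x1 (n u)))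
               (fun u => x2 (A u) * x2 (n u))).
      * apply (continuity_pt_opp (fun u => x1 (A u) * x1 (n u))).
        now apply (continuity_pt_mult (fun u => x1 (A u)) (fun u => x1 (n u))).
      * now apply (continuity_pt_mult (fun u => x2 (A u)) (fun u => x2 (n u))).
    + now apply (continuity_pt_mult (fun u => x3 (A u)) (fun u => x3 (n u))).
Qed.

(** * Comparison of the Frenet and Darboux frames *)

Lemma is_derive_E13_unique (f : R -> E13) (s : R) (v w : E13) :
  is_derive f s v -> is_derive f s w -> v = w.
Proof.
  intros Hv Hw.
  destruct (is_derive_coords _ _ _ Hv) as (V1 & V2 & V3).
  destruct (is_derive_coords _ _ _ Hw) as (W1 & W2 & W3).
  apply is_derive_unique in V1, V2, V3, W1, W2, W3.
  apply E13_ext; congruence.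
Qed.

(** The triple product has the sign opposite to the Euclidean one, so B x T = N in the Darboux
    frame. *)
Lemma cross_cross (N T : E13) :
  cross (cross N T) T = plus (scal (inner T T) N) (scal (- inner N T) T).
Proof.
  apply E13_ext; unfold inner, cross, x1, x2, x3, plus, scal; simpl;
    unfold plus, scal; simpl; unfold mult; simpl; ring.
Qed.

Lemma cross_linear_l (u v w : E13) (j k : R) :
  cross (plus (scal j u) (scal k v)) w = plus (scal j (cross u w)) (scal k (cross v w)).
Proof.
  apply E13_ext; unfold cross, x1, x2, x3, plus, scal; simpl;
    unfold plus, scal; simpl; unfold mult; simpl; ring.
Qed.

(* Tangency of T to M is not read off from the definition of the tangent plane:
   <N,T> = 0 comes from 0 = <T,T>'/2 = k_n <N,T>. *)
Lemma frame_relations (M : E13 -> Prop) (lo hi : Rbar)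
    (alpha T n b B N : R -> E13) (kappa tau kg kn taug phi : R -> R) :
  unit_speed_on M (interval lo hi) alpha T ->
  frenet (interval lo hi) T n b kappa tau ->
  (forall s, interval lo hi s -> kappa s <> 0) ->
  darboux M (interval lo hi) alpha T B N kg kn taug ->
  frames_angle (interval lo hi) kappa kg kn phi ->
  forall s, interval lo hi s ->
    inner (N s) (N s) = -1 /\ inner (T s) (T s) = 1 /\ inner (N s) (T s) = 0 /\
    n s = plus (scal (sinh (phi s)) (B s)) (scal (cosh (phi s)) (N s)) /\
    b s = plus (scal (sinh (phi s)) (N s)) (scal (cosh (phi s)) (B s)).
Proof.
  intros [_ Hu] Hfr Hk Hda Hang s Hs.
  destruct (Hda s Hs) as ([HN _] & HB & HT' & _).
  destruct (Hfr s Hs) as (HT & _ & _ & _ & _ & _ & Hb & HTn & _).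
  destruct (Hang s Hs) as [Ekn Ekg].
  assert (Hks := Hk s Hs).
  assert (HNT : inner (N s) (T s) = 0).
  { assert (D := is_derive_inner T T s _ _ HT' HT').
    apply (is_derive_interval_constant lo hi _ 1 s) in D; auto.
    - rewrite inner_plus_l, inner_plus_r, !inner_scal_l, !inner_scal_r,
        (inner_sym (T s)), (inner_sym (T s)), HB, inner_cross_r, Ekn in D.
      assert (P : kappa s * cosh (phi s) * inner (N s) (T s) = 0) by lra.
      assert (C := cosh_pos (phi s)).
      apply Rmult_integral in P as [P | P]; [| exact P].
      apply Rmult_integral in P as [P | P]; lra.
    - intros u Hiu. apply (Hu u Hiu). }
  assert (En : n s = plus (scal (sinh (phi s)) (B s)) (scal (cosh (phi s)) (N s))).
  (* Both frames express T', so kappa n = k_g B + k_n N; division by kappa isolates [n]. *)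
  { assert (E := is_derive_E13_unique _ _ _ _ HTn HT').
    assert (E' := f_equal (fun v : E13 => scal (/ kappa s) v : E13) E). cbv beta in E'.
    rewrite Ekn, Ekg in E'.
    rewrite scal_distr_l, !scal_assoc in E'.
    unfold mult in E'; simpl in E'.
    rewrite <- !Rmult_assoc, Rinv_l, !Rmult_1_l in E' by exact Hks.
    rewrite <- E'. symmetry. apply (scal_one (n s)). }
  repeat split; auto.
  (* Since b = n x T, the expansion of [n] is crossed with T, using B x T = N and N x T = B. *)
  rewrite Hb, En, cross_linear_l, HB, cross_cross, HT, HNT.
  apply E13_ext; unfold x1, x2, x3, plus, scal; simpl;
    unfold plus, scal; simpl; unfold mult; simpl; ring.
Qed.

(** * Coefficients of the axis, and inequalities for the converse *)

Lemma slant_helix_derivative (lo hi : Rbar) (t n b : R -> E13) (kappa tau : R -> R) (d : E13) :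
  frenet (interval lo hi) t n b kappa tau ->
  slant_helix (interval lo hi) n d ->
  forall s, interval lo hi s -> kappa s * inner (t s) d + tau s * inner (b s) d = 0.
Proof.
  intros Hfr [c Hc] s Hs.
  destruct (Hfr s Hs) as (_ & _ & _ & _ & _ & _ & _ & _ & Hn & _).
  apply (is_derive_inner_const _ _ _ d) in Hn.
  apply (is_derive_interval_constant lo hi _ c s) in Hn; auto.
  now rewrite inner_plus_l, !inner_scal_l in Hn.
Qed.

(** As (a,c) is perpendicular to (k,t), it equals l (t,-k), and its length gives l r = h or l r =
    -h. The sign of -c k = l k^2 is that of l, so the last hypothesis selects the case; for h = 0
    both coefficients vanish. *)
Lemma axis_coefficients (k t a c h e : R) :
  k <> 0 -> 0 <= h -> e = 1 \/ e = -1 -> k * a + t * c = 0 -> a ^ 2 + c ^ 2 = h ^ 2 ->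
  (h <> 0 -> 0 < e * - (c * k)) ->
  a = e * (t / sqrt (k ^ 2 + t ^ 2)) * h /\ c = - e * (k / sqrt (k ^ 2 + t ^ 2)) * h.
Proof.
  intros Hk Hh He Hac Hh2 Hs.
  assert (Hq : 0 < k ^ 2 + t ^ 2) by nra.
  set (r := sqrt (k ^ 2 + t ^ 2)).
  assert (Hr : 0 < r) by now apply sqrt_lt_R0.
  assert (Hr2 : r ^ 2 = k ^ 2 + t ^ 2) by (apply pow2_sqrt; lra).
  set (l := - c / k).
  assert (Ec : c = - l * k) by (unfold l; now field).
  assert (Ea : a = l * t).
  { apply (Rmult_eq_reg_l k); [rewrite Ec in Hac; lra | exact Hk]. }
  assert (Hl : (l * r) ^ 2 = h ^ 2).
  { rewrite Rpow_mult_distr, Hr2, <- Hh2, Ec, Ea. ring. }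
  assert (Elr : e * (l * r) = h).
  { destruct (Req_dec h 0) as [H0 | H0].
    - rewrite H0 in *. assert (l * r = 0) by nra. nra.
    - assert (P := Hs H0). rewrite Ec in P.
      assert (0 < e * l * k ^ 2) by lra.
      assert (0 < e * l).
      { apply (Rmult_lt_reg_r (k ^ 2)); [nra | lra]. }
      assert (0 < e * (l * r)) by (rewrite <- Rmult_assoc; apply Rmult_lt_0_compat; auto).
      destruct He as [-> | ->]; nra. }
  (* Uses e^2 = 1. *)
  assert (El : e * h = l * r) by (destruct He as [-> | ->]; lra).
  split.
  - rewrite Ea. replace (e * (t / r) * h) with (t * (e * h) / r) by (field; lra).
    rewrite El. field. lra.
  - rewrite Ec. replace (- e * (k / r) * h) with (- k * (e * h) / r) by (field; lra).
    rewrite El. field. lra.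
Qed.

Lemma slant_axis_coordinates (e theta : R) (kappa tau : R -> R) (T B N : R -> E13) (s : R) :
  inner (N s) (N s) = -1 -> inner (T s) (T s) = 1 -> inner (N s) (T s) = 0 ->
  B s = cross (N s) (T s) ->
  let d := slant_axis e theta kappa tau T B N s in
  inner (T s) d = e * (tau s / sqrt (kappa s ^ 2 + tau s ^ 2)) * sinh theta /\
  inner (B s) d = - e * (kappa s / sqrt (kappa s ^ 2 + tau s ^ 2)) * sinh theta /\
  inner (N s) d = - cosh theta.
Proof.
  intros HN HT HNT HB d.
  assert (HBT : inner (B s) (T s) = 0) by (rewrite HB; apply inner_cross_r).
  assert (HBN : inner (B s) (N s) = 0) by (rewrite HB; apply inner_cross_l).
  assert (HBB : inner (B s) (B s) = 1).
  { rewrite HB, inner_cross_cross, HN, HT, HNT. ring. }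
  unfold d, slant_axis.
  rewrite !inner_plus_r, !inner_scal_r.
  rewrite !(inner_sym (T s) (N s)), !(inner_sym (T s) (B s)), !(inner_sym (N s) (B s)).
  rewrite HN, HT, HNT, HBT, HBN, HBB. repeat split; ring.
Qed.

(** Works in the reverse direction to [axis_coefficients]. The bound follows from |k| <= r; with h =
    sinh theta it yields |c| < cosh theta. *)
Lemma axis_coefficients_bound (k t h e : R) :
  k <> 0 -> e = 1 \/ e = -1 ->
  let r := sqrt (k ^ 2 + t ^ 2) in
  k * (e * (t / r) * h) + t * (- e * (k / r) * h) = 0 /\ (- e * (k / r) * h) ^ 2 <= h ^ 2.
Proof.
  intros Hk He r.
  assert (Hr : 0 < r) by (apply sqrt_lt_R0; nra).
  assert (Hr2 : r ^ 2 = k ^ 2 + t ^ 2) by (apply pow2_sqrt; nra).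
  split; [field; lra |].
  assert (Hq : (k / r) ^ 2 <= 1).
  { assert (E : (k / r) ^ 2 * r ^ 2 = k ^ 2) by (field; lra).
    assert (0 < r ^ 2) by nra.
    apply (Rmult_le_reg_r (r ^ 2)); nra. }
  replace ((- e * (k / r) * h) ^ 2) with ((k / r) ^ 2 * h ^ 2)
    by (destruct He as [-> | ->]; ring).
  generalize (pow2_ge_0 h). nra.
Qed.

(** Squaring and using S^2 = (C - 1)(C + 1) lets C - 1 factor out. The other factor is negative, as
    c^2 < K^2 and C >= 1, so C = 1. *)
Lemma sinh_zero_of_slant (c S C K : R) :
  C ^ 2 = 1 + S ^ 2 -> 0 < C -> 0 < K -> c ^ 2 < K ^ 2 -> c * (C - 1) = S * K -> S = 0.
Proof.
  intros HC C0 K0 Hc E.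
  assert (H1 : (C - 1) * (c ^ 2 * (C - 1) - (C + 1) * K ^ 2) = 0).
  { assert (E2 : (c * (C - 1)) ^ 2 = (S * K) ^ 2) by now rewrite E.
    assert (HS : S ^ 2 = C ^ 2 - 1) by lra.
    rewrite !Rpow_mult_distr, HS in E2. lra. }
  assert (C1 : 1 <= C) by nra.
  assert (H2 : c ^ 2 * (C - 1) - (C + 1) * K ^ 2 < 0) by nra.
  apply Rmult_integral in H1 as [H1 | H1]; [| lra].
  assert (C = 1) by lra. nra.
Qed.

(** |S| < C and |c| < K. Geometrically, [n] and the projection of [d] to the plane of B and N are
    both timelike, so they cannot be orthogonal. *)
Lemma cosh_mult_dominates (c S C K : R) :
  C ^ 2 = 1 + S ^ 2 -> 0 < C -> 0 < K -> c ^ 2 < K ^ 2 -> S * c - C * K <> 0.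
Proof.
  intros HC C0 K0 Hc E.
  assert (E2 : (S * c) ^ 2 = (C * K) ^ 2) by (f_equal; lra).
  rewrite !Rpow_mult_distr, HC in E2.
  assert (0 <= S ^ 2 * (K ^ 2 - c ^ 2)) by (apply Rmult_le_pos; nra).
  nra.
Qed.

(** * Geodesic isophotes and slant helices *)

Theorem theorem2 :
  forall (M : E13 -> Prop) (lo hi : Rbar)
    (alpha T n b B N : R -> E13) (kappa tau kg kn taug phi : R -> R) (theta : R),
    Rbar_lt lo hi ->
    spacelike_surface M ->
    unit_speed_on M (interval lo hi) alpha T ->
    frenet (interval lo hi) T n b kappa tau ->
    (forall s, interval lo hi s -> kappa s <> 0) ->
    darboux M (interval lo hi) alpha T B N kg kn taug ->
    frames_angle (interval lo hi) kappa kg kn phi ->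
    isophote_timelike (interval lo hi) N theta ->
    (geodesic (interval lo hi) kg <->
     exists d : E13, timelike d /\ slant_helix (interval lo hi) n d /\
       exists e : R, (e = 1 \/ e = -1) /\
         forall s, interval lo hi s -> d = slant_axis e theta kappa tau T B N s).
Proof.
  intros M lo hi alpha T n b B N kappa tau kg kn taug phi theta
    Hlt _ Hus Hfr Hk Hda Hang Hiso.
  assert (HR := frame_relations _ _ _ _ _ _ _ _ _ _ _ _ _ _ _ Hus Hfr Hk Hda Hang).
  split.
  - intros Hgeo.
    destruct Hiso as [Hth (d & Hd & HNd)].
    (* Since kappa is nonzero, k_g = 0 forces sinh phi = 0 and cosh phi = 1, which merges the two
       frames. *)
    assert (Hframes : forall s, interval lo hi s -> n s = N s /\ b s = B s).
    { intros s Hs.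
      destruct (HR s Hs) as (_ & _ & _ & -> & ->).
      assert (S0 : sinh (phi s) = 0).
      { destruct (Hang s Hs) as [_ E]. rewrite (Hgeo s Hs) in E.
        symmetry in E. apply Rmult_integral in E as [E | E]; [destruct (Hk s Hs E) | exact E]. }
      assert (C1 : cosh (phi s) = 1).
      { generalize (cosh_sqr (phi s)) (cosh_pos (phi s)). rewrite S0. nra. }
      rewrite S0, C1.
      split; apply E13_ext; unfold x1, x2, x3, plus, scal; simpl;
        unfold plus, scal; simpl; unfold mult; simpl; ring. }
    assert (Hsl : slant_helix (interval lo hi) n d).
    { exists (- cosh theta). intros s Hs. destruct (Hframes s Hs) as [-> _]. apply (HNd s Hs). }
    set (a := fun s => inner (T s) d).
    set (c := fun s => inner (B s) d).
    assert (Hac : forall s, interval lo hi s -> kappa s * a s + tau s * c s = 0).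
    { intros s Hs. unfold a, c. destruct (Hframes s Hs) as [_ <-].
      exact (slant_helix_derivative _ _ _ _ _ _ _ _ Hfr Hsl s Hs). }
    assert (Hexp : forall s, interval lo hi s ->
      d = plus (plus (scal (a s) (T s)) (scal (c s) (B s))) (scal (cosh theta) (N s))).
    { intros s Hs.
      destruct (HR s Hs) as (HN & HT & HNT & _).
      destruct (Hda s Hs) as (_ & HB & _).
      rewrite (frame_expansion (N s) (T s) d HT HN HNT) at 1.
      destruct (HNd s Hs) as [_ ->].
      unfold a, c. now rewrite HB, Ropp_involutive. }
    assert (Hsq : forall s, interval lo hi s -> a s ^ 2 + c s ^ 2 = sinh theta ^ 2).
    { intros s Hs.
      assert (E : inner d d = a s * a s + c s * c s - cosh theta * cosh theta).
      { rewrite (Hexp s Hs) at 1.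
        rewrite !inner_plus_l, !inner_scal_l.
        destruct (HNd s Hs) as [_ ->]. unfold a, c. ring. }
      generalize (cosh_sqr theta). lra. }
    assert (Hcont : forall s, interval lo hi s -> continuity_pt (fun u => - (c u * kappa u)) s).
    { intros s Hs.
      apply (continuity_pt_opp (fun u => c u * kappa u)), continuity_pt_mult.
      - destruct (Hda s Hs) as (_ & _ & _ & HB' & _).
        exact (is_derive_continuity_pt _ _ _ (is_derive_inner_const _ _ _ d HB')).
      - exact (curvature_continuous _ _ _ _ _ _ _ _ _ Hus Hfr s Hs). }
    exists d. repeat split; auto.
    { unfold timelike. lra. }
    (* If sinh theta = 0 either sign works and 1 is taken; otherwise [e] is the sign of -c kappa at
       some point [s0], which persists by continuity. *)
    assert (He : exists e, (e = 1 \/ e = -1) /\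
      forall s, interval lo hi s -> sinh theta <> 0 -> 0 < e * - (c s * kappa s)).
    { destruct (Req_dec (sinh theta) 0) as [H0 | H0].
      { exists 1. split; [now left | tauto]. }
      (* If c vanished, kappa a + tau c = 0 would make a vanish too, against a^2 + c^2 = sinh^2
         theta. *)
      assert (Hnz : forall s, interval lo hi s -> - (c s * kappa s) <> 0).
      { intros s Hs E.
        assert (Hks := Hk s Hs). assert (P := Hac s Hs). assert (Q := Hsq s Hs).
        assert (c0 : c s = 0).
        { apply (Rmult_eq_reg_r (kappa s)); [lra | exact Hks]. }
        rewrite c0 in P, Q.
        assert (a0 : a s = 0).
        { apply (Rmult_eq_reg_l (kappa s)); [lra | exact Hks]. }
        rewrite a0 in Q. apply H0. nra. }
      assert (Hsign := interval_constant_sign lo hi _ Hcont Hnz). cbv beta in Hsign.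
      destruct (interval_inhabited lo hi Hlt) as [s0 Hs0].
      destruct (Rdichotomy _ _ (Hnz s0 Hs0)) as [F | F].
      - exists (-1). split; [now right |]. intros s Hs _. generalize (Hsign s0 s Hs0 Hs). nra.
      - exists 1. split; [now left |]. intros s Hs _. generalize (Hsign s0 s Hs0 Hs). nra. }
    destruct He as (e & He & Hes).
    exists e. split; [exact He |].
    intros s Hs.
    destruct (axis_coefficients (kappa s) (tau s) (a s) (c s) (sinh theta) e) as [Ea Ec];
      auto using sinh_nonneg.
    unfold slant_axis. rewrite <- Ea, <- Ec. now apply Hexp.
  - intros (d & _ & Hsl & e & He & Hd).
    assert (Hco : forall s, interval lo hi s ->
      kappa s * inner (T s) d + tau s * inner (B s) d = 0 /\
      inner (B s) d ^ 2 < cosh theta ^ 2 /\ inner (N s) d = - cosh theta).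
    { intros s Hs.
      destruct (HR s Hs) as (HN & HT & HNT & _).
      destruct (Hda s Hs) as (_ & HB & _).
      destruct (slant_axis_coordinates e theta kappa tau T B N s HN HT HNT HB) as (Ea & Ec & Eh).
      destruct (axis_coefficients_bound (kappa s) (tau s) (sinh theta) e (Hk s Hs) He)
        as [P Q].
      rewrite <- (Hd s Hs) in Ea, Ec, Eh.
      rewrite <- Ea, <- Ec in P. rewrite <- Ec in Q.
      repeat split; auto.
      rewrite (cosh_sqr theta). lra. }
    (* Nothing is assumed on the differentiability of [phi], so sinh phi is rewritten as <n,B>,
       which the frame equations can differentiate. *)
    assert (HnB : forall s, interval lo hi s -> inner (n s) (B s) = sinh (phi s)).
    { intros s Hs.
      destruct (HR s Hs) as (HN & HT & HNT & -> & _).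
      destruct (Hda s Hs) as (_ & -> & _).
      rewrite inner_plus_l, !inner_scal_l, inner_cross_cross, (inner_sym _ (cross _ _)),
        inner_cross_l, HN, HT, HNT. ring. }
    assert (Hprod : forall s, interval lo hi s -> inner (n s) (B s) * inner (T s) d = 0).
    { intros s Hs. rewrite (HnB s Hs).
      destruct (Hco s Hs) as (P & Q & Eh).
      assert (W := slant_helix_derivative _ _ _ _ _ _ _ _ Hfr Hsl s Hs).
      destruct (HR s Hs) as (_ & _ & _ & _ & Hb).
      (* With b = sinh phi N + cosh phi B, [W] minus [P] is tau (c (cosh phi - 1) - sinh phi cosh
         theta) = 0. *)
      rewrite Hb, inner_plus_l, !inner_scal_l, Eh in W.
      destruct (Req_dec (tau s) 0) as [T0 | T0].
      - rewrite T0 in P.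
        assert (a0 : inner (T s) d = 0).
        { apply (Rmult_eq_reg_l (kappa s)); [lra | exact (Hk s Hs)]. }
        rewrite a0. ring.
      - rewrite (sinh_zero_of_slant (inner (B s) d) (sinh (phi s)) (cosh (phi s)) (cosh theta));
          auto using cosh_sqr, cosh_pos.
        + ring.
        + apply (Rmult_eq_reg_l (tau s)); [lra | exact T0]. }
    intros s Hs.
    destruct (Hang s Hs) as [Ekn Ekg].
    rewrite Ekg.
    enough (E : sinh (phi s) = 0) by (rewrite E; ring).
    destruct (Hda s Hs) as (_ & _ & HT' & HB' & _).
    destruct (Hfr s Hs) as (_ & _ & _ & _ & _ & _ & _ & _ & Hn' & _).
    destruct (Hco s Hs) as (_ & Q & Eh).
    assert (Da := is_derive_inner_const _ _ _ d HT').
    assert (DS := is_derive_inner _ _ _ _ _ Hn' HB').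
    assert (D := is_derive_mult _ _ _ _ _ DS Da Rmult_comm).
    apply (is_derive_interval_constant lo hi _ 0 s) in D; auto.
    unfold plus, mult in D; simpl in D.
    rewrite (HnB s Hs) in D.
    assert (Z := Hprod s Hs). rewrite (HnB s Hs) in Z.
    (* Where a = 0, the product rule leaves only sinh phi times a'. *)
    apply Rmult_integral in Z as [Z | Z]; [exact Z |].
    rewrite Z, Rmult_0_r, Rplus_0_l in D.
    apply Rmult_integral in D as [D | D]; [exact D |].
    exfalso.
    (* Here a' = <T',d> = kappa (c sinh phi - cosh phi cosh theta), which cannot vanish. *)
    change (inner (plus (scal (kg s) (B s)) (scal (kn s) (N s))) d = 0) in D.
    rewrite inner_plus_l, !inner_scal_l, Eh, Ekn, Ekg in D.
    apply (cosh_mult_dominates (inner (B s) d) (sinh (phi s)) (cosh (phi s)) (cosh theta));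
      auto using cosh_sqr, cosh_pos.
    apply (Rmult_eq_reg_l (kappa s)); [lra | exact (Hk s Hs)].
Qed.
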